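(* (i) There exist non-trivial Fitting-degenerate prosoluble groups, all of whose Sylow subgroups are finite elementary abelian groups. (ii) For any distinct primes $p$ and $q$, there exist non-trivial Fitting-degenerate prosoluble groups which are countably based pro-$\{p,q\}$ groups.
   Context: Profinite groups are regarded as topological groups: subgroups are required to be closed, homomorphisms continuous, and generation means topological generation. For a profinite group $G$ and a prime $p$, $O_p(G)$ is the subgroup generated by all normal pro-$p$ subgroups of $G$; the Fitting subgroup $F(G)$ is the subgroup generated by the $O_p(G)$ for all primes $p$. A profinite group $Q$ is quasisimple if $Q$ is perfect and $Q/Z(Q)$ is simple. A component of $G$ is a subnormal quasisimple subgroup of $G$; the layer $E(G)$ is the subgroup generated by all components of $G$. The generalised Fitting subgroup $F^*(G)$ is the subgroup generated by $F(G)$ and $E(G)$. $G$ is Fitting-degenerate if $F^*(G)$ is trivial. *)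

(* Defs.v *)
From HB Require Import structures.
From mathcomp Require Import all_boot all_fingroup.
From mathcomp Require Import nilpotent pgroup.
From mathcomp Require Import classical_sets functions cardinality topology.

Set Implicit Arguments.
Unset Strict Implicit.
Unset Printing Implicit Defensive.

Local Open Scope classical_set_scope.
Local Open Scope group_scope.

HB.mixin Record isTopologicalGroup (G : Type)
    & monoid.Group G & Topological G := {
  mulg_continuous : continuous (fun xy : G * G => xy.1 * xy.2) ;
  invg_continuous : continuous (fun x : G => x^-1)
}.

#[short(type="topGroupType")]
HB.structure Definition TopologicalGroup :=
  {G of monoid.Group G & Topological G & isTopologicalGroup G}.

Definition profinite (G : topGroupType) : Prop :=
  [/\ compact [set: G], hausdorff_space G & totally_disconnected [set: G]].

Definition closed_subgroup (G : topGroupType) (H : set G) : Prop :=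
  [/\ closed H, H 1 & forall x y, H x -> H y -> H (x * y^-1)].

Definition normal_subgroup (G : topGroupType) (N H : set G) : Prop :=
  [/\ closed_subgroup N, N `<=` H & forall h n, H h -> N n -> N (n ^ h)].

Definition closed_gen (G : topGroupType) (A : set G) : set G :=
  smallest (@closed_subgroup G) A.

(* [f] is only constrained on the subgroup [H]; its values outside [H] are
   irrelevant. *)
Definition epimorphism_on (G K : groupType) (H : set G) (f : G -> K) : Prop :=
  (forall x y, H x -> H y -> f (x * y) = f x * f y) /\ f @` H = [set: K].

(* The finite group [gT] is discrete, so the continuity of [f] on [H] amounts
   to its kernel being open in [H]. *)
Definition finite_image (G : topGroupType) (H : set G) (gT : finGroupType) :
    Prop :=
  exists f : G -> gT,
    epimorphism_on H f /\ open (f @^-1` [set 1] : set (subspace H)).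

(* For closed subgroups [H] of a profinite group and a class [C] closed under
   isomorphism, quotients and subdirect products, [H] satisfies [pro C] iff it
   is an inverse limit of finite groups in [C]. *)
Definition pro (C : finGroupType -> Prop) (G : topGroupType) (H : set G) :
    Prop :=
  closed_subgroup H /\ forall gT : finGroupType, finite_image H gT -> C gT.

Definition pro_pi (pi : nat_pred) (G : topGroupType) (H : set G) : Prop :=
  pro (fun gT => pi.-group [set: gT]%SET) H.

Definition prosoluble (G : topGroupType) (H : set G) : Prop :=
  pro (fun gT => solvable [set: gT]%SET) H.

Definition sylow_subgroup (p : nat) (G : topGroupType) (S : set G) : Prop :=
  pro_pi p S /\ forall P : set G, pro_pi p P -> S `<=` P -> P = S.

Definition elementary_abelian (p : nat) (G : topGroupType) (S : set G) : Prop :=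
  [/\ closed_subgroup S, forall x y, S x -> S y -> commute x y
    & forall x, S x -> x ^+ p = 1].

Definition pcore_pro (p : nat) (G : topGroupType) : set G :=
  closed_gen (\bigcup_(N in [set N | normal_subgroup N setT /\ pro_pi p N]) N).

Definition fitting (G : topGroupType) : set G :=
  closed_gen (\bigcup_(p in [set p | prime p]) @pcore_pro p G).

Definition center_of (G : topGroupType) (Q : set G) : set G :=
  [set z | Q z /\ forall x, Q x -> commute z x].

Definition perfect (G : topGroupType) (Q : set G) : Prop :=
  closed_gen [set [~ x, y] | x in Q & y in Q] = Q.

Definition simple_group (G : topGroupType) (H : set G) : Prop :=
  H <> [set 1] /\
  forall N : set G, normal_subgroup N H -> N = [set 1] \/ N = H.

(* [f] exhibits [K], with the quotient topology, as [H / N]. *)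
Definition quotient_map (G K : topGroupType) (H N : set G) (f : G -> K) :
    Prop :=
  [/\ epimorphism_on H f,
      H `&` f @^-1` [set 1] = N
    & forall V : set K, open V <-> open (f @^-1` V : set (subspace H))].

Definition quasisimple (G : topGroupType) (Q : set G) : Prop :=
  [/\ closed_subgroup Q, perfect Q
    & exists (K : topGroupType) (f : G -> K),
        quotient_map Q (center_of Q) f /\ simple_group [set: K]].

Definition subnormal_subgroup (G : topGroupType) (Q : set G) : Prop :=
  exists (n : nat) (H : nat -> set G),
    [/\ H 0 = Q, H n = [set: G]
      & forall i, (i < n)%N -> normal_subgroup (H i) (H i.+1)].

Definition component (G : topGroupType) (Q : set G) : Prop :=
  subnormal_subgroup Q /\ quasisimple Q.

Definition layer (G : topGroupType) : set G :=
  closed_gen (\bigcup_(Q in @component G) Q).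

Definition generalised_fitting (G : topGroupType) : set G :=
  closed_gen (@fitting G `|` @layer G).

Definition fitting_degenerate (G : topGroupType) : Prop :=
  @generalised_fitting G = [set 1].

(* Main.v *)
(** The group is the inverse limit of the finite groups [G_0 = 1],
    [G_(n+1) = Z/l(n) wr G_n] (regular wreath products), for a sequence [l] of
    primes.  Let [N] be a normal pro-p subgroup and let [l(n) <> p].  The image
    of [N] in [G_(n+1)] meets the base group [B_n], an l(n)-group, trivially;
    being normal it centralises [B_n], and since [G_n] acts faithfully on [B_n]
    the image of [N] in [G_n] is trivial.  Hence [N = 1] as soon as infinitely
    many [l(n)] differ from [p], for instance when consecutive terms of [l] are
    distinct.  There are no components, because a prosoluble group has no
    nontrivial perfect closed subgroup.  An injective [l] gives (i): a pro-p
    subgroup embeds in the one base group [B_n] with [l(n) = p].  A sequence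
    [l] alternating between [p] and [q] gives (ii). *)

Require Import Defs.
From HB Require Import structures.
From mathcomp Require Import all_boot all_fingroup all_algebra.
From mathcomp Require Import cyclic commutator nilpotent pgroup.
From mathcomp Require Import mathcomp_extra boolp classical_sets functions.
From mathcomp Require Import cardinality topology.

Set Implicit Arguments.
Unset Strict Implicit.
Unset Printing Implicit Defensive.

Import GRing.Theory.

Local Open Scope classical_set_scope.
Local Open Scope group_scope.

(** * Regular wreath products with a cyclic base *)

Section Wreath.
Variables (l : nat) (gT : finGroupType).

Definition wreath : Type := ({ffun gT -> 'Z_l} * gT)%type.

HB.instance Definition _ := Finite.copy wreath ({ffun gT -> 'Z_l} * gT)%type.

Implicit Types u v w : wreath.

(** Right translation of the argument gives a left action: [translate (g * h)] is [translate g]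
    after [translate h]. *)
Definition translate (g : gT) (a : {ffun gT -> 'Z_l}) : {ffun gT -> 'Z_l} :=
  [ffun h => a (h * g)].

Definition wreath_one : wreath := (0%R, 1).
Definition wreath_mul u v : wreath :=
  ((u.1 + translate u.2 v.1)%R, u.2 * v.2).
Definition wreath_inv u : wreath := ((- translate u.2^-1 u.1)%R, u.2^-1).

Lemma wreath_mulA : associative wreath_mul.
Proof.
move=> [a g] [b h] [c k]; congr pair; last exact: mulgA.
by apply/ffunP => x; rewrite !ffunE /= addrA mulgA.
Qed.

Lemma wreath_mul1 : left_id wreath_one wreath_mul.
Proof.
move=> [a g]; congr pair; last exact: mul1g.
by apply/ffunP => x; rewrite !ffunE /= add0r mulg1.
Qed.

Lemma wreath_mulV : left_inverse wreath_one wreath_inv wreath_mul.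
Proof.
move=> [a g]; congr pair; last exact: mulVg.
by apply/ffunP => x; rewrite !ffunE /= addNr.
Qed.

HB.instance Definition _ :=
  Finite_isGroup.Build wreath wreath_mulA wreath_mul1 wreath_mulV.

Lemma wreath_base_commute u v : u.2 = 1 -> v.2 = 1 -> commute u v.
Proof.
case: u v => [a g] [b h] /= -> ->; congr pair.
by apply/ffunP => x; rewrite !ffunE /= !mulg1 addrC.
Qed.

Lemma wreath_base_expg u : 1 < l -> u.2 = 1 -> u ^+ l = 1.
Proof.
case: u => [a g] l_gt1 /= ->.
have uX k : ((a, 1) : wreath) ^+ k = ((a *+ k)%R, 1).
  elim: k => [|k IHk]; first by rewrite expg0 mulr0n.
  rewrite expgS IHk; congr pair; last exact: mulg1.
  by apply/ffunP => x; rewrite mulrS !ffunE /= mulg1.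
rewrite uX; congr pair; apply/ffunP => x.
by rewrite ffunMnE ffunE -mulr_natl pchar_Zp // mul0r.
Qed.

Lemma wreath_base_faithful u :
  1 < l -> (forall v, v.2 = 1 -> commute u v) -> u.2 = 1.
Proof.
pose delta : {ffun gT -> 'Z_l} := [ffun h => ((h == 1%g)%:R)%R].
case: u => [a g] l_gt1 /= /(_ (delta, 1) erefl).
(* Commutation with [(delta, 1)], evaluated at [1], reads [a 1 + delta g = delta 1 + a 1]; hence
   [delta g = 1] and [g = 1]. *)
case=> /ffunP/(_ 1) + _; rewrite !ffunE /= !mulg1 !mul1g eqxx addrC.
by move/addIr; case: eqP => // _ /esym/eqP; rewrite oner_eq0.
Qed.

Lemma card_wreath : #|{: wreath}| = (#|'Z_l| ^ #|gT| * #|gT|)%N.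
Proof. by rewrite card_prod card_ffun. Qed.

Lemma wreath_pgroup (pi : nat_pred) : prime l -> l \in pi ->
  pi.-group [set: gT]%SET -> pi.-group [set: wreath]%SET.
Proof.
move=> l_pr pi_l; rewrite /pgroup !cardsT card_wreath => pi_gT.
rewrite pnatM pi_gT andbT pnatX card_ord Zp_cast ?prime_gt1 //.
by rewrite pnatE // pi_l.
Qed.

(** The projection to [gT] has the abelian base group as kernel and a solvable image. *)
Lemma wreath_sol : solvable [set: gT]%SET -> solvable [set: wreath]%SET.
Proof.
move=> sol_gT.
have top_morph : {in [set: wreath]%SET &, {morph snd : u v / u * v}} by [].
pose top := Morphism top_morph.
have /= nK := ker_normal [morphism of top].
rewrite (series_sol nK); apply/andP; split.
  apply: abelian_sol; apply/centsP => u /mker Ku v /mker Kv.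
  exact: wreath_base_commute.
rewrite (isog_sol (first_isog top)).
by apply: (@solvableS gT [set: gT]%G) => //; apply: finset.subsetT.
Qed.

End Wreath.

(** * Closure properties of closed subgroups *)

Section ClosedSubgroup.
Variables (G : topGroupType) (H : set G).
Hypothesis clH : closed_subgroup H.

Lemma closed_subgroup_inv x : H x -> H x^-1.
Proof. by case: clH => _ H1 HM Hx; rewrite -[x^-1]mul1g; apply: HM. Qed.

Lemma closed_subgroup_mul x y : H x -> H y -> H (x * y).
Proof.
case: clH => _ _ HM Hx Hy; rewrite -[y]invgK.
exact/HM/closed_subgroup_inv.
Qed.

Lemma closed_subgroup_expg x n : H x -> H (x ^+ n).
Proof.
move=> Hx; elim: n => [|n IHn]; first by case: clH.
by rewrite expgS; apply: closed_subgroup_mul.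
Qed.

(** Assuming only [H (x ^ y)] lets [y] range over the whole group when [H] is normal. *)
Lemma closed_subgroup_comm x y : H x -> H (x ^ y) -> H [~ x, y].
Proof.
by move=> Hx; rewrite commgEl; apply/closed_subgroup_mul/closed_subgroup_inv.
Qed.

End ClosedSubgroup.

(** * The inverse limit of iterated wreath products as a group *)

Section WreathLimit.
Variable l : nat -> nat.

Fixpoint tower n : finGroupType :=
  if n is m.+1 then wreath (l m) (tower m) else 'I_1.

Definition base_at n := {ffun tower n -> 'Z_(l n)}.

(* As a space the limit is the product of the base groups: [x n] is the
   component in the n-th base group and [trunc n x] the image in [tower n]. *)
Definition wreath_limit : Type :=
  prod_topology (fun n => discrete_topology (base_at n)).

HB.instance Definition _ := Topological.copy wreath_limit
  (prod_topology (fun n => discrete_topology (base_at n))).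

Fixpoint trunc n (x : wreath_limit) : tower n :=
  if n is m.+1 then ((x m, trunc m x) : wreath (l m) (tower m)) else ord0.


Lemma trunc_inj x y : (forall n, trunc n x = trunc n y) -> x = y.
Proof.
move=> eq_xy; apply/functional_extensionality_dep => n.
by case: (eq_xy n.+1).
Qed.

Lemma trunc_le m n x y :
  m <= n -> trunc n x = trunc n y -> trunc m x = trunc m y.
Proof.
elim: n => [|n IHn]; first by rewrite leqn0 => /eqP->.
rewrite leq_eqVlt => /predU1P[-> //|/IHn{}IHn] [_].
exact: IHn.
Qed.

Lemma trunc_surj n (g : tower n) : exists x, trunc n x = g.
Proof.
pose K n := forall g : tower n, exists x, trunc n x = g.
suff: K n by apply.
elim: {g}n => [g|n IHn [a g]]; first by exists (fun=> 0%R); rewrite (ord1 g).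
have [x xE] := IHn g.
(* Coordinate [n] of [x] is overwritten by [a]; this leaves [trunc n] unchanged, since it reads only
   coordinates below [n]. *)
exists (@dfwith _ base_at x n a) => /=; congr pair; first by rewrite dfwithin.
suff trunc_dfwith m :
    m <= n -> trunc m (@dfwith _ base_at x n a) = trunc m x.
  by rewrite trunc_dfwith.
elim: m => //= m IHm ltmn.
by rewrite IHm 1?ltnW // dfwithout // neq_ltn ltmn orbT.
Qed.

Definition limit_one : wreath_limit := fun=> 0%R.
(** Coordinate [n] of a product involves only coordinates up to [n] of the factors, so it is
    computed in [tower n.+1]. The group laws then transfer from the towers by [trunc_inj]. *)
Definition limit_mul (x y : wreath_limit) : wreath_limit :=
  fun n => (trunc n.+1 x * trunc n.+1 y).1.
Definition limit_inv (x : wreath_limit) : wreath_limit :=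
  fun n => (trunc n.+1 x)^-1.1.

Lemma trunc_one n : trunc n limit_one = 1.
Proof. by elim: n => [|n /= ->]. Qed.

Lemma trunc_mul n : {morph trunc n : x y / limit_mul x y >-> x * y}.
Proof.
move=> x y; elim: n => [|n /= ->] //.
by rewrite (ord1 (_ * _)).
Qed.

Lemma trunc_inv n : {morph trunc n : x / limit_inv x >-> x^-1}.
Proof.
move=> x; elim: n => [|n /= ->] //.
by rewrite (ord1 (_^-1)).
Qed.

Lemma limit_mulA : associative limit_mul.
Proof. by move=> x y z; apply: trunc_inj => n; rewrite !trunc_mul mulgA. Qed.
Lemma limit_mul1r : left_id limit_one limit_mul.
Proof.
by move=> x; apply: trunc_inj => n; rewrite trunc_mul trunc_one mul1g.
Qed.

Lemma limit_mulr1 : right_id limit_one limit_mul.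
Proof.
by move=> x; apply: trunc_inj => n; rewrite trunc_mul trunc_one mulg1.
Qed.

Lemma limit_mulVr : left_inverse limit_one limit_inv limit_mul.
Proof.
by move=> x; apply: trunc_inj => n; rewrite trunc_mul trunc_inv trunc_one mulVg.
Qed.
Lemma limit_mulrV : right_inverse limit_one limit_inv limit_mul.
Proof.
by move=> x; apply: trunc_inj => n; rewrite trunc_mul trunc_inv trunc_one mulgV.
Qed.

HB.instance Definition _ := isGroup.Build wreath_limit
  limit_mulA limit_mul1r limit_mulr1 limit_mulVr limit_mulrV.

(** * Topology of the limit: cylinders, continuity, profiniteness *)

Lemma open_trunc n (A : set (tower n)) : open (trunc n @^-1` A).
Proof.
suff open1 g : open (trunc n @^-1` [set g]).
  rewrite (_ : _ @^-1` _ = \bigcup_(g in A) trunc n @^-1` [set g]).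
    exact: bigcup_open.
  by apply/seteqP; split=> [x Ax|x [g Ag /= ->]] //; exists (trunc n x).
elim: n g {A} => [|n IHn] g.
  rewrite (_ : _ @^-1` _ = setT); first exact: openT.
  by apply/seteqP; split=> // x _ /=; rewrite (ord1 g).
rewrite (_ : _ @^-1` _ = proj n @^-1` [set g.1] `&` trunc n @^-1` [set g.2]).
  apply: openI (IHn _); apply: open_comp (discrete_open _).
  by move=> x _; apply: proj_continuous.
by case: g => a g; apply/seteqP; split=> x /= [<- <-].
Qed.

Lemma trunc_nbhs x (U : set wreath_limit) :
  nbhs x U -> exists n, trunc n @^-1` [set trunc n x] `<=` U.
Proof.
move: U.
pose F := filter_from [set: nat] (fun n => trunc n @^-1` [set trunc n x]).
have FF : Filter F.
  apply: filter_from_filter; first by exists 0.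
  move=> m n _ _; exists (maxn m n) => // y /= eq_xy.
  by split; apply: trunc_le eq_xy; rewrite ?leq_maxl ?leq_maxr.
suff: F --> x by move=> cvgF U /cvgF [n _ nU]; exists n.
(* Convergence in the product topology is coordinatewise, and coordinate [i] is constant on the
   cylinder of level [i.+1]. *)
apply/cvg_sup => i U [_ [[W _ <-] Wx WU]].
by exists i.+1 => // y [/= eq_xy _]; apply: WU; rewrite /= eq_xy.
Qed.

Lemma nbhs_trunc n x : nbhs x (trunc n @^-1` [set trunc n x]).
Proof. by apply: open_nbhs_nbhs; split=> //; apply: open_trunc. Qed.

Lemma closed_trunc n (A : set (tower n)) : closed (trunc n @^-1` A).
Proof. by rewrite -openC; apply: (open_trunc (~` A)). Qed.

Lemma limit_mul_continuous :
  continuous (fun xy : wreath_limit * wreath_limit => xy.1 * xy.2).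
Proof.
case=> x y U /= /trunc_nbhs[n nU].
exists (trunc n @^-1` [set trunc n x], trunc n @^-1` [set trunc n y]).
  by split; apply: nbhs_trunc.
by case=> x' y' /= [x'E y'E]; apply: nU; rewrite /= !trunc_mul x'E y'E.
Qed.

Lemma limit_inv_continuous : continuous (fun x : wreath_limit => x^-1).
Proof.
move=> x U /= /trunc_nbhs[n nU]; apply: filterS (nbhs_trunc n x) => y /= yE.
by apply: nU; rewrite /= !trunc_inv yE.
Qed.

HB.instance Definition _ := isTopologicalGroup.Build wreath_limit
  limit_mul_continuous limit_inv_continuous.

Lemma limit_hausdorff : hausdorff_space wreath_limit.
Proof. by apply: hausdorff_product => n; apply: discrete_hausdorff. Qed.

Lemma limit_profinite : profinite wreath_limit.
Proof.
split; last 1 first.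
- have: zero_dimensional wreath_limit.
    by apply: zero_dimension_prod => n; apply: discrete_zero_dimension.
  exact: zero_dimension_totally_disconnected.
- have fin_base n : finite_set [set: discrete_topology (base_at n)].
    exact: (@finite_finset (base_at n)).
  have := tychonoff (fun n => finite_compact (fin_base n)).
  by congr compact; apply/seteqP; split.
exact: limit_hausdorff.
Qed.

Lemma limit_second_countable : @second_countable wreath_limit.
Proof.
pose cylinder (k : {n : nat & tower n}) := trunc (tag k) @^-1` [set tagged k].
exists (range cylinder).
  by apply: card_le_trans (card_image_le _ _) _; apply: countableP.
split=> [_ [k _ <-]|x U /trunc_nbhs[n nU]]; first exact: open_trunc.
exists (trunc n @^-1` [set trunc n x]) => //.
by split=> //; exists (Tagged tower (trunc n x)).
Qed.

(** * Finite images, prosolubility and perfect subgroups *)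

Lemma truncM n : {morph trunc n : x y / x * y}.
Proof. exact: trunc_mul. Qed.
Lemma truncV n : {morph trunc n : x / x^-1}.
Proof. exact: trunc_inv. Qed.
Lemma trunc1 n : trunc n 1 = 1.
Proof. exact: trunc_one. Qed.
Lemma truncR n : {morph trunc n : x y / [~ x, y]}.
Proof. by move=> x y; rewrite !(truncM, truncV). Qed.
Lemma truncX n k : {morph trunc n : x / x ^+ k}.
Proof.
by move=> x; elim: k => [|k IHk]; rewrite ?trunc1 // !expgS truncM IHk.
Qed.

Lemma closed_subgroup1 : @closed_subgroup wreath_limit [set 1].
Proof.
split=> // [|x y -> ->]; last by rewrite mulgV.
exact: accessible_closed_set1 (hausdorff_accessible limit_hausdorff) 1.
Qed.


Lemma trunc_image_group_set n (H : set wreath_limit) : closed_subgroup H ->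
  group_set (finset.finset (fun g : tower n => `[< (trunc n @` H) g >])).
Proof.
move=> clH; apply/group_setP; split=> [|g h].
  rewrite finset.in_set; apply/asboolP; exists 1; rewrite ?trunc1 //.
  by case: clH.
rewrite !finset.in_set => /asboolP[x Hx <-] /asboolP[y Hy <-]; apply/asboolP.
by exists (x * y); [apply: closed_subgroup_mul | apply: truncM].
Qed.

Definition trunc_image n H (clH : closed_subgroup H) : {group tower n} :=
  Group (trunc_image_group_set n clH).

Lemma mem_trunc_image n H (clH : closed_subgroup H) g :
  reflect (exists2 x, H x & trunc n x = g) (g \in trunc_image n clH).
Proof. by rewrite finset.in_set; apply: asboolP. Qed.

(** Supplies the finite quotients at which a hypothesis [pro C H] is applied. *)
Lemma finite_image_trunc n H (clH : closed_subgroup H) :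
  Defs.finite_image H (subg_of (trunc_image n clH)).
Proof.
have imH x : H x -> trunc n x \in trunc_image n clH.
  by move=> Hx; apply/mem_trunc_image; exists x.
exists (fun x => subg (trunc_image n clH) (trunc n x)); split; last first.
  apply: open_subspaceW.
  exact: (open_trunc [set g | subg (trunc_image n clH) g = 1]).
split=> [x y /imH Ax /imH Ay|]; first by rewrite truncM subgM.
apply/seteqP; split=> // -[g Ag] _; have /mem_trunc_image[x Hx xg] := Ag.
by exists x => //; rewrite xg; apply: val_inj; rewrite /= subgK.
Qed.

Lemma pro_pi_elt pi H n x : pro_pi pi H -> H x -> pi.-elt (trunc n x).
Proof.
case=> clH /(_ _ (finite_image_trunc n clH)) piA Hx.
apply: (mem_p_elt (G := trunc_image n clH)).
  by rewrite /pgroup (card_isog (isog_subg _)).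
by apply/mem_trunc_image; exists x.
Qed.

(** The open kernel contains a cylinder around [1], so the map factors through some truncation. *)
Lemma finite_image_tower gT : Defs.finite_image [set: wreath_limit] gT ->
  exists n, exists f : {morphism [set: tower n]%SET >-> gT},
    f @* [set: tower n]%SET = [set: gT]%SET.
Proof.
move=> [f [[fM f_surj] /open_subspaceP[V oV]]]; rewrite !setIT => VE.
have f1 : f 1 = 1 by apply: (mulgI (f 1)); rewrite -fM // !mulg1.
have /trunc_nbhs[n nV] : nbhs 1 V.
  by apply: open_nbhs_nbhs; split=> //; rewrite VE.
have f_trunc x y : trunc n x = trunc n y -> f x = f y.
  move=> eq_xy; rewrite -[x](mulgKV y) fM // [f (_ * _)](_ : _ = 1) ?mul1g //.
  have := nV (x * y^-1); rewrite VE; apply.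
  by rewrite /= truncM truncV eq_xy mulgV trunc1.
(* [s] is a mere set-theoretic section; [f \o s] is still a morphism because [f] depends only on
   [trunc n]. *)
pose s (g : tower n) := projT1 (cid (trunc_surj g)).
have sK g : trunc n (s g) = g by rewrite /s; case: cid.
have fsM : {in [set: tower n]%SET &, {morph f \o s : g h / g * h}}.
  by move=> g h _ _ /=; rewrite -fM //; apply: f_trunc; rewrite truncM !sK.
exists n, (Morphism fsM); apply/finset.setP => a; rewrite inE.
have /seteqP[_ /(_ a I)[x _ <-]] := f_surj.
apply/morphimP; exists (trunc n x); rewrite ?inE //=.
by apply: f_trunc; rewrite sK.
Qed.

Lemma tower_sol n : solvable [set: tower n]%SET.
Proof.
elim: n => [|n IHn]; last exact: wreath_sol.
by apply/abelian_sol/centsP => x _ y _; rewrite /commute (ord1 x) (ord1 y).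
Qed.

Lemma closed_subgroupT : @closed_subgroup wreath_limit setT.
Proof. by split; first exact: closedT. Qed.

Lemma limit_prosoluble : prosoluble [set: wreath_limit].
Proof.
split=> [|gT /finite_image_tower[n [f <-]]]; first exact: closed_subgroupT.
exact/morphim_sol/tower_sol.
Qed.

(** Let [A] be the image of [Q] in [tower n]. The preimage of its derived subgroup is closed and
    contains all commutators of [Q], hence [Q] itself; so [A] is perfect, and solvability of the
    tower makes it trivial. *)
Lemma perfect_limit_trivial (Q : set wreath_limit) :
  closed_subgroup Q -> perfect Q -> Q `<=` [set 1].
Proof.
move=> clQ perfQ x Qx; apply: (@trunc_inj _ 1) => n; rewrite trunc1.
pose A := trunc_image n clQ.
have imQ y : Q y -> trunc n y \in A.
  by move=> Qy; apply/mem_trunc_image; exists y.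
have sAA' : A \subset A^`(1).
  apply/fintype.subsetP => _ /mem_trunc_image[y Qy <-]; move: Qy.
  rewrite -perfQ.
  apply: (smallest_sub (X := trunc n @^-1` [set g | g \in A^`(1)])).
    split; first exact: closed_trunc.
      by rewrite /= trunc1 group1.
    by move=> u v /= Au Av; rewrite truncM truncV groupM ?groupV.
  by move=> _ [u Qu [v Qv <-]] /=; rewrite truncR mem_commg ?imQ.
have [A1 | ntA] := eqVneq (A :> {set _}) 1.
  by apply/set1gP; rewrite -A1 imQ.
have /properP[_ [g Ag]] := sol_der1_proper (tower_sol n) (finset.subsetT A) ntA.
by rewrite (fintype.subsetP sAA').
Qed.

(** * Pro-p subgroups and Fitting-degeneracy *)

Hypothesis l_prime : forall n, prime (l n).

Lemma tower_pgroup pi n :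
  (forall m, l m \in pi) -> pi.-group [set: tower n]%SET.
Proof.
move=> pi_l; elim: n => [|n IHn]; last exact: wreath_pgroup.
by rewrite /pgroup cardsT card_ord.
Qed.

Lemma limit_pro_pi pi :
  (forall n, l n \in pi) -> pro_pi pi [set: wreath_limit].
Proof.
move=> pi_l; split=> [|gT /finite_image_tower[n [f <-]]].
  exact: closed_subgroupT.
exact/morphim_pgroup/tower_pgroup.
Qed.

(** The image in [tower n.+1] lies in the base group, so its order divides the prime [l n]; it is
    also a power of [p]. *)
Lemma pro_p_trunc p H n x : prime p -> pro_pi p H -> H x ->
  l n != p -> trunc n x = 1 -> trunc n.+1 x = 1.
Proof.
move=> p_pr ppH Hx l_n_p x1; apply/eqP; rewrite -order_eq1.
have := pro_pi_elt n.+1 ppH Hx; rewrite /p_elt => pnat_x.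
have : #[trunc n.+1 x] %| l n.
  by rewrite order_dvdn; apply/eqP/wreath_base_expg; rewrite ?prime_gt1.
case/primeP: (l_prime n) => _ dvd_l /dvd_l /orP[// | /eqP xl].
by move: pnat_x; rewrite xl pnatE // inE (negPf l_n_p).
Qed.

Lemma normal_pro_p_trivial p N : prime p ->
  (forall n, l n != l n.+1) ->
  normal_subgroup N [set: wreath_limit] -> pro_pi p N -> N `<=` [set 1].
Proof.
move=> p_pr l_neq [clN _ NJ] ppN z Nz.
apply: (@trunc_inj _ 1) => m.
(* One of the consecutive terms [l m] and [l m.+1] differs from [p]. *)
have [n le_mn l_n_p] : exists2 n, m <= n & l n != p.
  have [lmp|] := eqVneq (l m) p; last by exists m.
  by exists m.+1; rewrite // -lmp eq_sym.
apply: trunc_le le_mn _; rewrite trunc1.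
apply: (@wreath_base_faithful _ _ (trunc n.+1 z)); first exact/prime_gt1.
move=> v v1; have [y yv] := trunc_surj (v : tower n.+1).
have y1 : trunc n y = 1 by rewrite -v1 -yv.
(* The commutator lies in [N] by normality and is trivial at level [n] because [y] is, so
   [pro_p_trunc] applies to it. *)
suff zy1 : trunc n.+1 [~ z, y] = 1.
  by apply/commgP/eqP; rewrite -yv; move: zy1; rewrite truncR.
apply: pro_p_trunc ppN _ l_n_p _ => //.
  by apply: closed_subgroup_comm => //; apply: NJ.
by rewrite truncR y1 commg1.
Qed.

Lemma closed_gen_trivial (A : set wreath_limit) :
  A `<=` [set 1] -> closed_gen A `<=` [set 1].
Proof. exact: smallest_sub closed_subgroup1. Qed.

Lemma limit_fitting_degenerate :
  (forall n, l n != l n.+1) -> fitting_degenerate wreath_limit.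
Proof.
move=> l_neq; apply/seteqP; split; last by move=> _ -> M [[]].
apply: closed_gen_trivial => x [|].
  apply: closed_gen_trivial => y [p /= p_pr].
  apply: closed_gen_trivial => z [N /= [nN ppN] Nz].
  exact: normal_pro_p_trivial p_pr l_neq nN ppN _ Nz.
apply: closed_gen_trivial => y [Q /= [_ [clQ perfQ _]] Qy].
exact: perfect_limit_trivial clQ perfQ _ Qy.
Qed.

Lemma limit_nontrivial : [set: wreath_limit] <> [set 1].
Proof.
move=> GT1; have [x x1] := @trunc_surj 1 ([ffun=> 1%R], 1%g).
have xE : [set 1] x by rewrite -GT1.
move: x1; rewrite xE trunc1 => /(congr1 fst)/ffunP/(_ 1).
by rewrite !ffunE => /esym/eqP; rewrite oner_eq0.
Qed.

(** * Pro-p subgroups for an injective sequence of primes *)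

Lemma pro_p_trunc_below p H n x : prime p -> pro_pi p H -> H x ->
  (forall m, m < n -> l m != p) -> trunc n x = 1.
Proof.
move=> p_pr ppH Hx; elim: n => [|n IHn] l_not_p.
  by rewrite (ord1 (trunc 0 x)) -(ord1 1).
apply: pro_p_trunc ppH Hx (l_not_p n _) (IHn _) => // m lt_mn.
exact/l_not_p/ltnW.
Qed.

Lemma pro_p_trunc_above p H n x : prime p -> pro_pi p H -> H x ->
  (forall m, n <= m -> l m != p) -> trunc n x = 1 -> x = 1.
Proof.
move=> p_pr ppH Hx l_not_p x1; apply: trunc_inj => m.
have [le_mn | /ltnW le_nm] := leqP m n.
  by apply: trunc_le le_mn _; rewrite x1 trunc1.
rewrite trunc1 -(subnKC le_nm); elim: (m - n)%N => [|k IHk].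
  by rewrite addn0.
by rewrite addnS; apply: pro_p_trunc ppH Hx (l_not_p _ (leq_addr _ _)) IHk.
Qed.

Lemma pro_p_elementary p (H : set wreath_limit) :
  injective l -> prime p -> pro_pi p H ->
  finite_set H /\ elementary_abelian p H.
Proof.
move=> l_inj p_pr ppH; have clH : closed_subgroup H by case: ppH.
(* [n] is the index with [l n = p], or [0] if [p] does not occur. *)
have [n l_below l_above] : exists2 n,
    forall m, m < n -> l m != p & forall m, n < m -> l m != p.
  have [[n lnp] | l_not_p] := pselect (exists n, l n = p).
    exists n => m; rewrite -lnp (inj_eq l_inj) neq_ltn => ->; rewrite ?orbT //.
  by exists 0 => // m _; apply/eqP => lmp; apply: l_not_p; exists m.
have below x : H x -> trunc n x = 1.
  by move=> Hx; apply: pro_p_trunc_below ppH Hx l_below.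
have above x : H x -> trunc n.+1 x = 1 -> x = 1.
  by move=> Hx; apply: pro_p_trunc_above ppH Hx l_above.
split; last first.
  split=> // [x y Hx Hy | x Hx].
    (* By [above], the commutator need only vanish at level [n.+1], where both images lie in the
       abelian base group. *)
    apply/commgP/eqP/above; last rewrite truncR.
      by apply: closed_subgroup_comm => //; rewrite /conjg;
         do !apply: closed_subgroup_mul => //; apply: closed_subgroup_inv.
    by apply/eqP/commgP; apply: wreath_base_commute; apply: below.
  apply: above; first exact: closed_subgroup_expg.
  rewrite truncX; have [lnp | lnp] := eqVneq (l n) p.
    by rewrite -[in LHS]lnp; apply/wreath_base_expg/below; rewrite ?prime_gt1.
  by rewrite (pro_p_trunc p_pr ppH Hx lnp (below x Hx)) expg1n.
(* Finiteness: [H] embeds in the finite group [tower n.+1]. *)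
have trunc_injH : {in H &, injective (trunc n.+1)}.
  move=> x y /set_mem Hx /set_mem Hy eq_xy; apply/(mulIg y^-1).
  rewrite mulgV; apply: above; last by rewrite truncM truncV eq_xy mulgV.
  by apply: closed_subgroup_mul => //; apply: closed_subgroup_inv.
rewrite -(eq_finite_set (inj_card_eq trunc_injH)).
exact: (@finite_finset (tower n.+1)).
Qed.

End WreathLimit.

(** * Choice of the prime sequences and conclusion *)

Fixpoint prime_seq n : nat :=
  if n is m.+1 then s2val (prime_above (prime_seq m)) else 2.

Lemma prime_seq_prime n : prime (prime_seq n).
Proof. by case: n => //= n; case: prime_above. Qed.

Lemma prime_seq_inj : injective prime_seq.
Proof.
have lt_seq : {homo prime_seq : m n / m < n}.
  by apply: homo_ltn ltn_trans _ => n /=; case: prime_above.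
by move=> m n eq_mn; case: (ltngtP m n) => // /lt_seq; rewrite eq_mn ltnn.
Qed.

Theorem mainTheorem5 :
  (exists G : topGroupType,
     [/\ profinite G, [set: G] <> [set 1], fitting_degenerate G,
         prosoluble [set: G]
       & forall (p : nat) (S : set G), prime p -> sylow_subgroup p S ->
           finite_set S /\ elementary_abelian p S]) /\
  (forall p q : nat, prime p -> prime q -> p <> q ->
     exists G : topGroupType,
       [/\ profinite G, [set: G] <> [set 1], fitting_degenerate G,
           prosoluble [set: G]
         & @second_countable G /\ pro_pi (pred2 p q) [set: G]]).
Proof.
split=> [|p q p_pr q_pr neq_pq].
  exists (wreath_limit prime_seq); split.
  - exact: limit_profinite.
  - exact: limit_nontrivial.
  - apply: limit_fitting_degenerate prime_seq_prime _ => n.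
    by rewrite (inj_eq prime_seq_inj) neq_ltn leqnn.
  - exact: limit_prosoluble.
  move=> p S p_pr [ppS _].
  exact: (pro_p_elementary prime_seq_prime prime_seq_inj p_pr ppS).
(* Alternation makes consecutive terms distinct while keeping every term in [pred2 p q]. *)
pose l n := if odd n then p else q.
have l_prime n : prime (l n) by rewrite /l; case: ifP.
exists (wreath_limit l); split.
- exact: limit_profinite.
- exact: limit_nontrivial.
- apply: limit_fitting_degenerate l_prime _ => n.
  by rewrite /l /=; case: (odd n) => /=; apply/eqP => // /esym.
- exact: limit_prosoluble.
split; first exact: limit_second_countable.
apply: (limit_pro_pi l_prime) => n.
by rewrite /l inE; case: ifP; rewrite eqxx ?orbT.
Qed.
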